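(* Let $r,s\in\mathbb{N}\cup\{0\}$. For each $\alpha\in\mathbb{R}$, the operators $\imath^{\alpha}:=\imath_{\mathbb{C}}\colon\mathrm{h}_{\alpha-1}\mathcal{T}^r_{s+1}(M_A)\to\mathrm{h}_{\alpha}\mathcal{T}^r_{s}(M_A)$ and $\dot\partial_{\alpha}:=\dot\partial\colon\mathrm{h}_{\alpha}\mathcal{T}^r_{s}(M_A)\to\mathrm{h}_{\alpha-1}\mathcal{T}^r_{s+1}(M_A)$ satisfy $$\imath^{\alpha}\circ\dot\partial_{\alpha}=\alpha\,\mathrm{Id}.$$ As consequences, if $\alpha\neq 0$, then $\imath^{\alpha}$ is surjective, $\dot\partial_{\alpha}$ is injective, and $$\mathrm{h}_{\alpha-1}\mathcal{T}^r_{s+1}(M_A)=\mathrm{Img}(\dot\partial_{\alpha})\oplus\mathrm{Ker}(\imath^{\alpha}),$$ with the corresponding projections being given by $$\mathrm{h}_{\alpha-1}\mathcal{T}^r_{s+1}(M_A)\to\mathrm{Img}(\dot\partial_{\alpha}),\quad S\mapsto\dot\partial\left(\tfrac1\alpha\,\imath_{\mathbb{C}}S\right);$$ $$\mathrm{h}_{\alpha-1}\mathcal{T}^r_{s+1}(M_A)\to\mathrm{Ker}(\imath^{\alpha}),\quad S\mapsto S-\dot\partial\left(\tfrac1\alpha\,\imath_{\mathbb{C}}S\right).$$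
   Context: $M$ is a smooth (Hausdorff, second countable) $n$-dimensional manifold and $A\subseteq \mathrm{T}M\setminus\mathbf{0}$ is an open subset (where $\mathbf 0$ is the zero section) such that every fiber $A_p:=A\cap \mathrm{T}_pM$, $p\in M$, is nonempty and conic (if $v\in A_p$ then $\lambda v\in A_p$ for all $\lambda\in\mathbb{R}^+=(0,\infty)$). $\pi_A\colon A\to M$ is the restriction of the natural projection. All objects are assumed to be smooth, where smooth means $\mathcal{C}^m$ with $m$ large enough that all the derivatives considered of anisotropic tensors exist and are continuous on $A$. $\mathcal{T}^r_s(M_A)$ is the set of $A$-anisotropic tensors of type $(r,s)$, i.e. sections of the pullback bundle $\pi_A^*(\mathrm{T}M^{\otimes r}\otimes \mathrm{T}^*M^{\otimes s})\to A$. In natural coordinates $(x^i,y^i)$ on $\mathrm{T}M$ associated with coordinates $(x^i)$ on $M$, such a tensor is $T=T^{i_1\ldots i_r}_{j_1\ldots j_s}(x,y)\,\partial_{x^{i_1}}\otimes\cdots\otimes\partial_{x^{i_r}}\otimes \mathrm{d}x^{j_1}\otimes\cdots\otimes \mathrm{d}x^{j_s}$ (Einstein convention). For $\alpha\in\mathbb{R}$, $\mathrm{h}_\alpha\mathcal{T}^r_s(M_A)\subset\mathcal{T}^r_s(M_A)$ is the subset of $\alpha$-homogeneous tensors: $T^{i_1\ldots i_r}_{j_1\ldots j_s}(x,\lambda y)=\lambda^\alpha T^{i_1\ldots i_r}_{j_1\ldots j_s}(x,y)$ for all $\lambda\in\mathbb{R}^+$. The Liouville (canonical) field is $\mathbb{C}\in\mathrm{h}_1\mathcal{T}^1_0(M_A)$,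 $\mathbb{C}_v:=v$, i.e. $\mathbb{C}=y^i\partial_{x^i}$. The vertical derivative of $T\in\mathcal{T}^r_s(M_A)$ is $\dot\partial T\in\mathcal{T}^r_{s+1}(M_A)$ with components $(\dot\partial T)^{i_1\ldots i_r}_{j_1\ldots j_s k}=\partial T^{i_1\ldots i_r}_{j_1\ldots j_s}/\partial y^k$ (derivation index last). For $S\in\mathcal{T}^r_{s+1}(M_A)$, $\imath_{\mathbb{C}}S\in\mathcal{T}^r_s(M_A)$ is the contraction of $\mathbb{C}$ with the last covariant index: $(\imath_{\mathbb{C}}S)^{i_1\ldots i_r}_{j_1\ldots j_s}=S^{i_1\ldots i_r}_{j_1\ldots j_s a}y^a$. The maps $\dot\partial$ and $\imath_{\mathbb{C}}$ restrict to the homogeneous subspaces as in the claim. $\mathrm{Img}$ and $\mathrm{Ker}$ denote image and kernel. *)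

(* Defs.v *)
From HB Require Import structures.
From mathcomp Require Import all_boot all_order all_algebra.
From mathcomp Require Import all_classical all_reals all_analysis.
Import Order.TTheory GRing.Theory Num.Theory numFieldNormedType.Exports.

Set Implicit Arguments.
Unset Strict Implicit.
Unset Printing Implicit Defensive.

Local Open Scope classical_set_scope.
Local Open Scope ring_scope.

Section smooth.
Context {R : realType} {V W : normedModType R}.

(* Only used for finite-dimensional [V], where continuity of all the
   directional derivatives amounts to continuity of the differential. *)
Fixpoint Ck (k : nat) (U : set V) (f : V -> W) : Prop :=
  if k is k'.+1 then
    (forall x, U x -> differentiable f x) /\ (forall v, Ck k' U ('D_v f))
  else forall x, U x -> {for x, continuous f}.

Definition smooth_on (U : set V) (f : V -> W) : Prop := forall k, Ck k U f.

End smooth.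

Lemma derive_comp (R : realType) (U V W : normedModType R) (f : U -> V)
    (g : V -> W) x y :
  differentiable f x -> differentiable g (f x) ->
  'D_y (g \o f) x = 'D_('D_y f x) g (f x).
Proof.
move=> df dg; rewrite (deriveE _ df) (deriveE _ dg).
by rewrite (deriveE _ (differentiable_comp df dg)) diff_comp.
Qed.

(* Only the values of [cfun] on [cdom] and of [cinv] on [ccod] are meaningful. *)
Record chart (R : realType) (n : nat) (M : topologicalType) := Chart {
  cdom : set M;
  ccod : set 'rV[R]_n;
  cfun : M -> 'rV[R]_n;
  cinv : 'rV[R]_n -> M;
  open_cdom : open cdom;
  open_ccod : open ccod;
  cfun_fun : set_fun cdom ccod cfun;
  cinv_fun : set_fun ccod cdom cinv;
  cfunK : {in cdom, cancel cfun cinv};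
  cinvK : {in ccod, cancel cinv cfun};
  cfun_continuous : {in cdom, continuous cfun};
  cinv_continuous : {in ccod, continuous cinv} }.

Definition transition (R : realType) (n : nat) (M : topologicalType)
  (c c' : chart R n M) : 'rV[R]_n -> 'rV[R]_n := cfun c' \o cinv c.

Record smooth_manifold (R : realType) (n : nat) := SmoothManifold {
  carrier :> topologicalType;
  manifold_hausdorff : hausdorff_space carrier;
  manifold_second_countable : @second_countable carrier;
  atlas : set (chart R n carrier);
  atlas_cover : forall p : carrier, exists2 c, atlas c & cdom c p;
  atlas_compatible : forall c c', atlas c -> atlas c' ->
    smooth_on (cfun c @` (cdom c `&` cdom c')) (transition c c') }.

Record chart_at (R : realType) (n : nat) (M : smooth_manifold R n) (p : M) :=
  ChartAt {
    chart_of :> chart R n M;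
    chart_in_atlas : atlas chart_of;
    chart_around : cdom chart_of p }.

Section tangent.
Context {R : realType} {n : nat} {M : smooth_manifold R n}.
Implicit Types p : M.

(* [jacobian] acts on row vectors from the right: [v *m jacobian f x] is the
   differential of [f] at [x] applied to [v]. *)
Definition jac p (c c' : chart_at p) : 'M[R]_n :=
  jacobian (transition c c') (cfun c p).

Lemma transition_open (c c' : chart R n M) :
  open (cfun c @` (cdom c `&` cdom c')).
Proof.
have -> : cfun c @` (cdom c `&` cdom c') = ccod c `&` cinv c @^-1` (cdom c').
  apply/seteqP; split => [_ [p [cp c'p] <-]|x [cx c'x]].
    split; first exact: cfun_fun.
    by rewrite /preimage /= cfunK// inE.
  exists (cinv c x); last by rewrite cinvK// inE.
  by split => //; exact: cinv_fun.
rewrite openE => x [cx c'x]; apply: filterI.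
  exact: (open_nbhs_nbhs (conj (@open_ccod _ _ _ c) cx)).
apply: cinv_continuous; rewrite ?inE//.
exact: (open_nbhs_nbhs (conj (@open_cdom _ _ _ c') c'x)).
Qed.

Lemma transition_differentiable p (c c' : chart_at p) :
  differentiable (transition c c') (cfun c p).
Proof.
have [+ _] := atlas_compatible (chart_in_atlas c) (chart_in_atlas c') 1%N.
by apply; exists p => //; split; exact: chart_around.
Qed.

Lemma mul_jac p (c c' : chart_at p) (y : 'rV[R]_n) :
  y *m jac c c' = 'D_y (transition c c') (cfun c p).
Proof. exact/esym/deriveEjacobian/transition_differentiable. Qed.

Lemma jac_comp p (c c' c'' : chart_at p) : jac c c' *m jac c' c'' = jac c c''.
Proof.
have tp : transition c c' (cfun c p) = cfun c' p.
  by rewrite /transition /= cfunK// inE; exact: chart_around.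
suff E y : 'D_('D_y (transition c c') (cfun c p)) (transition c' c'') (cfun c' p)
           = 'D_y (transition c c'') (cfun c p).
  apply/row_matrixP => i; rewrite !rowE mulmxA; move: (delta_mx _ _) => y.
  apply: (etrans (mul_jac c' c'' _)); apply: (etrans _ (esym (mul_jac c c'' y))).
  by rewrite -E; congr derive; exact: mul_jac.
have dcc' := transition_differentiable c c'.
have dc'c'' := transition_differentiable c' c''.
rewrite -tp in dc'c'' *; rewrite -(derive_comp _ dcc' dc'c'').
apply: near_eq_derive.
have : nbhs (cfun c p) (cfun c @` (cdom c `&` cdom c')).
  apply: open_nbhs_nbhs; split; first exact: transition_open.
  by exists p => //; split; exact: chart_around.
apply: filterS => _ [q [cq c'q] <-].
by rewrite /transition /= !cfunK ?inE.
Qed.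

Lemma jac_id p (c : chart_at p) : jac c c = 1%:M.
Proof.
apply/row_matrixP => i; rewrite !rowE mulmx1; move: (delta_mx _ _) => y.
apply: (etrans (mul_jac c c y)).
rewrite (@near_eq_derive _ _ _ _ id) ?derive_id//.
have : nbhs (cfun c p) (ccod c).
  apply: open_nbhs_nbhs; split; first exact: open_ccod.
  by apply: cfun_fun; exact: chart_around.
by apply: filterS => x cx; rewrite /transition /= cinvK ?inE.
Qed.

(* A tangent vector at [p] is the family of its coordinate vectors in the
   charts around [p], related by the Jacobians of the coordinate changes. *)
Definition tangent_law p : {pred (chart_at p -> 'rV[R]_n)} :=
  [pred y | `[< forall c c', y c' = y c *m jac c c' >]].
Arguments tangent_law p : clear implicits.

Record tangent_space p := TangentVector {
  tcoord : chart_at p -> 'rV[R]_n;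
  tcoordP : tcoord \in tangent_law p }.

Fact tangent_law_submod p : submod_closed (tangent_law p).
Proof.
split => [|a y z]; first by apply: asboolT => c c'; rewrite mul0mx.
move=> /asboolW yP /asboolW zP; apply: asboolT => c c'.
by rewrite mulmxDl -scalemxAl -yP -zP.
Qed.

HB.instance Definition _ p := GRing.isSubmodClosed.Build R _ (tangent_law p)
  (GRing.submod_closed_semi (tangent_law_submod p)).

HB.instance Definition _ p := [isSub for @tcoord p].
HB.instance Definition _ p := [Choice of tangent_space p by <:].
HB.instance Definition _ p :=
  [SubChoice_isSubLmodule of tangent_space p by <:].

Fact of_coord_subproof p (c : chart_at p) (y : 'rV[R]_n) :
  (fun c' => y *m jac c c') \in tangent_law p.
Proof. by apply: asboolT => c' c''; rewrite -mulmxA jac_comp. Qed.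

Definition of_coord p (c : chart_at p) (y : 'rV[R]_n) : tangent_space p :=
  TangentVector (of_coord_subproof c y).

Lemma tcoord_of_coord p (c : chart_at p) y : tcoord (of_coord c y) c = y.
Proof. by rewrite /= jac_id mulmx1. Qed.

Lemma of_coord_tcoord p (c : chart_at p) (v : tangent_space p) :
  of_coord c (tcoord v c) = v.
Proof.
apply: val_inj; apply: funext => c' /=.
by have /asboolW vP := tcoordP v; rewrite -vP.
Qed.

Lemma tcoordD p (u v : tangent_space p) c :
  tcoord (u + v) c = tcoord u c + tcoord v c.
Proof. by []. Qed.

Lemma tcoordZ p a (v : tangent_space p) c :
  tcoord (a *: v) c = a *: tcoord v c.
Proof. by []. Qed.

End tangent.
Arguments tangent_space {R n M} p.

Section dual.
Context {R : realType} (V : lmodType R).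

Definition linear_form : {pred V -> R^o} := [pred f | `[< scalar f >]].

Record dual := Covector {
  covector_fun :> V -> R^o;
  covectorP : covector_fun \in linear_form }.

Fact linear_form_submod : submod_closed linear_form.
Proof.
split => [|a f g].
  by apply: asboolT => b u v /=; rewrite mulr0 addr0.
move=> /asboolW fP /asboolW gP; apply: asboolT => b u v.
rewrite !fctE fP gP /= !scalerDr mulrDr !scalerA /GRing.scale /= !mulrA.
by rewrite (mulrC b a) addrACA.
Qed.

HB.instance Definition _ := GRing.isSubmodClosed.Build R _ linear_form
  (GRing.submod_closed_semi linear_form_submod).

HB.instance Definition _ := [isSub for covector_fun].
HB.instance Definition _ := [Choice of dual by <:].
HB.instance Definition _ := [SubChoice_isSubLmodule of dual by <:].

End dual.
Arguments linear_form {R} V _.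

Section coordinate_frame.
Context {R : realType} {n : nat} {M : smooth_manifold R n}.

Definition cotangent_space (p : M) := dual (tangent_space p).

(* The coordinate vector fields $\partial_{x^j}$ and differentials
   $\mathrm{d}x^i$ of a chart. *)
Definition partial_ (p : M) (c : chart_at p) (j : 'I_n) : tangent_space p :=
  of_coord c (delta_mx 0 j).

Fact dx_subproof (p : M) (c : chart_at p) (i : 'I_n) :
  (fun v : tangent_space p => tcoord v c 0 i : R^o) \in linear_form _.
Proof. by apply: asboolT => a u v; rewrite /= !mxE. Qed.

Definition dx (p : M) (c : chart_at p) (i : 'I_n) : cotangent_space p :=
  Covector (dx_subproof c i).

Definition tangent_bundle : Type := {p : M & tangent_space p}.

Definition bundle_point (p : M) (v : tangent_space p) : tangent_bundle :=
  existT _ p v.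

(* The natural coordinates $(x, y)$ of the points of [A] lying over the domain
   of [c]. *)
Definition natural_image (A : set tangent_bundle) (c : chart R n M) :
    set ('rV[R]_n * 'rV[R]_n) :=
  [set xy | exists (p : M) (h : chart_at p) (v : tangent_space p),
    [/\ chart_of h = c, A (bundle_point v) & xy = (cfun c p, tcoord v h)]].

(* The natural charts are homeomorphisms from an open cover of the tangent
   bundle onto open subsets of $\mathbb{R}^n \times \mathbb{R}^n$. *)
Definition bundle_open (A : set tangent_bundle) : Prop :=
  forall c, atlas c -> open (natural_image A c).

Record conic_domain (A : set tangent_bundle) : Prop := ConicDomain {
  conic_open : bundle_open A;
  conic_slit : forall p : M, ~ A (bundle_point (0 : tangent_space p));
  conic_nonempty : forall p : M, exists v : tangent_space p, A (bundle_point v);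
  conic_scale : forall (p : M) (v : tangent_space p) (lambda : R),
    0 < lambda -> A (bundle_point v) -> A (bundle_point (lambda *: v)) }.

End coordinate_frame.
Arguments tangent_bundle {R n} M.

(* A type $(r,s)$ tensor on a vector space is a multilinear function of [r]
   covectors and [s] vectors.  An anisotropic tensor is stored as its extension
   by zero outside [A], so that equality of fields is equality of functions;
   [tensor_field] is the ambient space of all functions of this shape. *)
Definition tensor_field (R : realType) (n : nat) (M : smooth_manifold R n)
    (r s : nat) : Type :=
  forall (p : M) (v : tangent_space p),
    ('I_r -> cotangent_space p) -> ('I_s -> tangent_space p) -> R.

Section tensor_field_lmod.
Context {R : realType} {n : nat} {M : smooth_manifold R n} {r s : nat}.
Local Notation TF := (tensor_field M r s).
Implicit Types T S : TF.

HB.instance Definition _ := gen_eqMixin TF.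
HB.instance Definition _ := gen_choiceMixin TF.

Let zero : TF := fun _ _ _ _ => 0.
Let opp T : TF := fun p v w X => - T p v w X.
Let add T S : TF := fun p v w X => T p v w X + S p v w X.
Let scale a T : TF := fun p v w X => a * T p v w X.

Lemma tensor_fieldP T S : (forall p v w X, T p v w X = S p v w X) -> T = S.
Proof.
move=> TS; do 2 apply: functional_extensionality_dep => ?.
by do 2 apply: funext => ?.
Qed.

Fact addA : associative add.
Proof. by move=> *; apply: tensor_fieldP => *; exact: addrA. Qed.
Fact addC : commutative add.
Proof. by move=> *; apply: tensor_fieldP => *; exact: addrC. Qed.
Fact add0 : left_id zero add.
Proof. by move=> *; apply: tensor_fieldP => *; exact: add0r. Qed.
Fact addN : left_inverse zero opp add.
Proof. by move=> *; apply: tensor_fieldP => *; exact: addNr. Qed.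

HB.instance Definition _ := GRing.isZmodule.Build TF addA addC add0 addN.

Fact scaleA a b T : scale a (scale b T) = scale (a * b) T.
Proof. by apply: tensor_fieldP => *; exact: mulrA. Qed.
Fact scale1 : left_id 1 scale.
Proof. by move=> *; apply: tensor_fieldP => *; exact: mul1r. Qed.
Fact scaleDr : right_distributive scale +%R.
Proof. by move=> *; apply: tensor_fieldP => *; exact: mulrDr. Qed.
Fact scaleDl T : {morph scale^~ T : a b / a + b}.
Proof. by move=> *; apply: tensor_fieldP => *; exact: mulrDl. Qed.

HB.instance Definition _ :=
  GRing.Zmodule_isLmodule.Build R TF scaleA scale1 scaleDr scaleDl.

End tensor_field_lmod.

Definition multilinear {R : realType} {V : lmodType R} {k : nat}
    (f : ('I_k -> V) -> R) : Prop :=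
  forall (X : 'I_k -> V) (b : 'I_k), scalar (fun u => f (dfwith X b u)).

Definition extend_last {V : Type} {s : nat} (X : 'I_s -> V) (u : V) :
    'I_s.+1 -> V :=
  fun b => oapp X u (unlift ord_max b).

Section anisotropic.
Context {R : realType} {n : nat} {M : smooth_manifold R n}.
Variable A : set (tangent_bundle M).

(* [f] is the component $T^{i_1\ldots i_r}_{j_1\ldots j_s}(x,y)$ of [T] in the
   natural coordinates associated with [c]. *)
Definition is_component {r s} (T : tensor_field M r s) (c : chart R n M)
    (i : 'I_r -> 'I_n) (j : 'I_s -> 'I_n) (f : 'rV[R]_n * 'rV[R]_n -> R) :=
  forall (p : M) (h : chart_at p) (v : tangent_space p), chart_of h = c ->
    A (bundle_point v) ->
    f (cfun c p, tcoord v h) = T p v (dx h \o i) (partial_ h \o j).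

Record anisotropic_tensor (r s : nat) (T : tensor_field M r s) : Prop :=
  AnisotropicTensor {
    aniso_supp : forall (p : M) (v : tangent_space p),
      ~ A (bundle_point v) -> forall w X, T p v w X = 0;
    aniso_contra : forall (p : M) (v : tangent_space p) X,
      multilinear (T p v ^~ X);
    aniso_cov : forall (p : M) (v : tangent_space p) w,
      multilinear (T p v w);
    aniso_smooth : forall c, atlas c -> forall i j,
      exists2 f, smooth_on (natural_image A c) f & is_component T c i j f }.

Definition homogeneous_tensor (alpha : R) (r s : nat) :
    set (tensor_field M r s) :=
  [set T | anisotropic_tensor T /\
    forall (p : M) (v : tangent_space p) (lambda : R),
      A (bundle_point v) -> 0 < lambda ->
      forall w X, T p (lambda *: v) w X = lambda `^ alpha * T p v w X].

(* $(\dot\partial T)_v(\omega, X_1, \ldots, X_{s+1}) =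
   \frac{d}{dt}|_{t=0} T_{v + t X_{s+1}}(\omega, X_1, \ldots, X_s)$;
   see [vertical_derivative_component] for the coordinate expression. *)
Definition vertical_derivative {r s} (T : tensor_field M r s) :
    tensor_field M r s.+1 :=
  fun p v w X =>
    if `[< A (bundle_point v) >] then
      derive1 (fun t : R => T p (v + t *: X ord_max) w (X \o lift ord_max)) 0
    else 0.

Definition liouville (p : M) (v : tangent_space p) : tangent_space p := v.

Definition liouville_contraction {r s} (S : tensor_field M r s.+1) :
    tensor_field M r s :=
  fun p v w X => S p v w (extend_last X (liouville v)).

Lemma vertical_derivative_component r s (T : tensor_field M r s)
    (c : chart R n M) i j f (k : 'I_n) :
  atlas c -> bundle_open A -> is_component T c i j f ->
  is_component (vertical_derivative T) c i (extend_last j k)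
    ('D_((0 : 'rV[R]_n), (delta_mx 0 k : 'rV[R]_n)) f).
Proof.
move=> cA Aop Tf p h v hc Av; rewrite /vertical_derivative asboolT//.
have last_k : (partial_ h \o extend_last j k) ord_max = partial_ h k.
  by rewrite /extend_last /= unlift_none.
have init_j : (partial_ h \o extend_last j k) \o lift ord_max = partial_ h \o j.
  by apply: funext => b; rewrite /extend_last /= liftK.
rewrite last_k init_j; set e := (0, delta_mx 0 k).
rewrite derive1E; set a := (cfun c p, tcoord v h).
have line t : tcoord (v + t *: partial_ h k) h = tcoord v h + t *: delta_mx 0 k.
  by rewrite tcoordD tcoordZ tcoord_of_coord.
have nearA : \forall t \near (0 : R), A (bundle_point (v + t *: partial_ h k)).
  have cvgA : t *: e + a @[t --> (0 : R)] --> a.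
    rewrite -[X in _ --> X]add0r -[X in X + _](scale0r e).
    by apply: cvgD; [exact: scalel_continuous|exact: cvg_cst].
  have : \forall t \near (0 : R), natural_image A c (t *: e + a).
    apply: cvgA; apply: open_nbhs_nbhs; split; first exact: Aop.
    by exists p, h, v.
  apply: filterS => t [q [h' [u [h'c Au [+ uE]]]]].
  rewrite /= scaler0 add0r => /(congr1 (cinv c)).
  rewrite !cfunK ?inE -?h'c//; last 2 first.
  - exact: chart_around.
  - by rewrite h'c -hc; exact: chart_around.
  move=> pq; subst q.
  suff -> : v + t *: partial_ h k = u by [].
  have hh' : h = h'.
    case: h h' hc h'c {Tf last_k init_j line u Au uE a cvgA} => [d dA dp] [d' dA' dp'] /= dc d'c.
    by subst d d'; congr ChartAt; exact: Prop_irrelevance.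
  rewrite -hh' in uE.
  rewrite -[LHS](of_coord_tcoord h) -[RHS](of_coord_tcoord h) -uE line.
  by rewrite addrC.
have eqf : \forall t \near (0 : R),
    T p (v + t *: partial_ h k) (dx h \o i) (partial_ h \o j) = f (t *: e + a).
  apply: filterS nearA => t /(Tf _ h _ hc) <-; rewrite line; congr f.
  by rewrite /e /a; congr pair; rewrite /= ?scaler0 ?add0r// addrC.
rewrite (near_eq_derive _ eqf).
suff quotE : (fun t : R => t^-1 *: ((f \o shift a) (t *: e) - f a)) =
    (fun t : R => t^-1 *: (((fun u : R => f (u *: e + a)) \o shift 0) (t *: 1) -
                           f (0 *: e + a))).
  by rewrite /derive quotE.
by apply: funext => t; rewrite /= addr0 scale0r add0r /GRing.scale /= mulr1.
Qed.

Lemma liouville_contraction_component r s (S : tensor_field M r s.+1)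
    (c : chart R n M) i j f :
  anisotropic_tensor S ->
  (forall a, is_component S c i (extend_last j a) (f a)) ->
  is_component (liouville_contraction S) c i j
    (fun xy => \sum_a f a xy * xy.2 0 a).
Proof.
move=> aS Sf p h v hc Av; rewrite /liouville_contraction /liouville.
have extE u : extend_last (partial_ h \o j) u =
    dfwith (extend_last (partial_ h \o j) v) ord_max u.
  apply: funext => b; rewrite /extend_last; case: unliftP => [b' ->|->] /=.
    by rewrite dfwithout/= ?liftK// neq_lift.
  by rewrite dfwithin.
pose phi u : R^o := S p v (dx h \o i) (extend_last (partial_ h \o j) u).
have phi_linear : scalar phi.
  move=> a u u'; rewrite /phi (extE (a *: u + u')) (extE u) (extE u').
  exact: (aniso_cov aS v (dx h \o i) _ ord_max a u u').
have phi_sum (F : 'I_n -> R) (u : 'I_n -> tangent_space p) :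
    phi (\sum_a F a *: u a) = \sum_a F a * phi (u a).
  have phi0 : phi 0 = 0.
    by have := phi_linear (-1) 0 0; rewrite scaler0 addr0 mulN1r addNr.
  by elim/big_rec2: _ => // a x y _ <-; rewrite phi_linear.
rewrite -[LHS]/(\sum_a f a (cfun c p, tcoord v h) * tcoord v h 0 a).
rewrite -[RHS]/(phi v).
have vE : v = \sum_a tcoord v h 0 a *: partial_ h a.
  apply: (can_inj (of_coord_tcoord h)); rewrite {1}[tcoord v h]row_sum_delta.
  have -> : forall F : 'I_n -> tangent_space p,
      tcoord (\sum_a F a) h = \sum_a tcoord (F a) h.
    move=> F; pose tc := fun u : tangent_space p => tcoord u h.
    by apply: (big_morph tc) => // u u'; exact: tcoordD.
  by apply: eq_bigr => a _; rewrite tcoordZ tcoord_of_coord.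
rewrite [X in phi X]vE phi_sum; apply: eq_bigr => a _.
rewrite (Sf a p h v hc Av) mulrC /phi; congr (_ * S p v _ _).
by apply: funext => b; rewrite /extend_last /=; case: unlift.
Qed.

End anisotropic.

Section direct_sum.
Context {R : realType} {V : lmodType R}.

Definition subspace (U : set V) : Prop :=
  U 0 /\ forall (a : R) u v, U u -> U v -> U (a *: u + v).

Definition direct_sum (W U1 U2 : set V) : Prop :=
  [/\ subspace W, subspace U1, subspace U2,
      W = [set u1 + u2 | u1 in U1 & u2 in U2] &
      U1 `&` U2 = [set 0]].

(* [P] is the projection of the direct sum [W] of [U1] and [U2] onto [U1]. *)
Definition projection (W U1 U2 : set V) (P : V -> V) : Prop :=
  set_fun W U1 P /\ forall u1 u2, U1 u1 -> U2 u2 -> P (u1 + u2) = u1.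

End direct_sum.

(* Main.v *)
(* Along a ray, t |-> T_(v + t v) = (1 + t)^alpha T_v near t = 0, so its
   derivative at 0 is alpha T_v: this is Euler's identity, and for alpha != 0 it
   makes alpha^-1 times the contraction a left inverse of the vertical
   derivative, which splits the target.  The analytic content lies in showing
   that both operators preserve anisotropic tensors.  The components of T are
   only known to be smooth on coordinate frames, so differentiability of
   T(w, X) along the fibres is first extended to all arguments w, X by
   multilinearity. *)

Require Import Defs.
From HB Require Import structures.
From mathcomp Require Import all_boot all_order all_algebra.
From mathcomp Require Import all_classical all_reals all_analysis.
Import Order.TTheory GRing.Theory Num.Theory numFieldNormedType.Exports.

Set Implicit Arguments.
Unset Strict Implicit.
Unset Printing Implicit Defensive.

Local Open Scope classical_set_scope.
Local Open Scope ring_scope.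

(** * Calculus of smooth functions on open sets *)

Section smooth_functions.
Context {R : realType} {V W : normedModType R}.
Implicit Types (U : set V) (f g : V -> W).

(** The difference of [f] and [g] vanishes near [x], so it is absorbed in the little-o term: the
    differential of [f] also gives a first-order expansion of [g], and [diff_unique] identifies it
    as that of [g]. *)
Lemma near_eq_differentiable f g x :
  (\near x, f x = g x) -> differentiable f x -> differentiable g x.
Proof.
move=> fg df; have gx : f x = g x by exact: nbhs_singleton fg.
have cdf : continuous ('d f x) by exact: diff_continuous.
have gE : g \o shift x = cst (g x) + 'd f x +o_ 0 id.
  apply: (@eqaddo_trans _ _ _ _ _ _ (f \o shift x)); last first.
    by rewrite -gx; exact: diff_locally.
  apply/eqaddoP => e e0; near=> h.
  rewrite /= !fctE /= (_ : f (h + x) = g (h + x)) ?subrr ?normr0.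
    by rewrite mulr_ge0 // ltW.
  near: h.
  have : \forall h \near x, f h = g h by [].
  rewrite nearE (near_shift 0 x).
  by apply: filterS => h /=; rewrite subr0.
apply/diff_locallyP; rewrite (diff_unique cdf gE); split => //.
Unshelve. all: by end_near.
Qed.

(** Openness of [U] turns equality on [U] into equality near each of its points, so the directional
    derivatives agree on [U] too and the induction applies to them. This is what allows
    differentiation rules valid only on [U] to be used inside [Ck]. *)
Lemma Ck_ext k U f g :
  open U -> (forall x, U x -> f x = g x) -> Ck k U f -> Ck k U g.
Proof.
move=> oU; elim: k f g => [|k IHk] f g fg /=.
  move=> cf x Ux; have fgx := fg _ Ux.
  have near_fg : \forall y \near x, f y = g y.
    by apply: filterS fg _; exact: open_nbhs_nbhs.
  suff : g y @[y --> x] --> g x by [].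
  by rewrite -fgx; apply: cvg_trans (cf x Ux); exact: near_eq_cvg.
move=> [df Ckf]; have near_fg x : U x -> \forall y \near x, f y = g y.
  by move=> Ux; apply: filterS fg _; exact: open_nbhs_nbhs.
split=> [x Ux|v]; first exact: near_eq_differentiable (near_fg _ Ux) (df _ Ux).
by apply: IHk (Ckf v) => x Ux; exact: near_eq_derive (near_fg _ Ux).
Qed.

Lemma smooth_on_derive U f v : smooth_on U f -> smooth_on U ('D_v f).
Proof. by move=> sf k; have [_ Dk] := sf k.+1; exact: Dk. Qed.

Lemma smooth_on_differentiable U f x :
  smooth_on U f -> U x -> differentiable f x.
Proof. by move=> sf Ux; have [df _] := sf 1%N; exact: df. Qed.

Lemma smooth_on_cst U (a : W) : smooth_on U (cst a).
Proof.
move=> k; elim: k a => [|k IHk] a /=.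
  by move=> x _; exact: cst_continuous.
split=> // v; rewrite (_ : 'D_v (cst a) = cst 0) //.
by apply: funext => x; exact: derive_cst.
Qed.

Lemma CkD k U f g : open U -> Ck k U f -> Ck k U g -> Ck k U (f + g).
Proof.
move=> oU; elim: k f g => [|k IHk] f g /=.
  by move=> cf cg x Ux; exact: continuousD (cf x Ux) (cg x Ux).
move=> [df Cf] [dg Cg]; split=> [x Ux|v].
  exact: differentiableD (df x Ux) (dg x Ux).
apply: Ck_ext oU _ (IHk _ _ (Cf v) (Cg v)) => x Ux.
exact: esym (deriveD (diff_derivable (df x Ux)) (diff_derivable (dg x Ux))).
Qed.

Lemma smooth_onD U f g :
  open U -> smooth_on U f -> smooth_on U g -> smooth_on U (f + g).
Proof. by move=> oU sf sg k; exact: CkD oU (sf k) (sg k). Qed.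

End smooth_functions.

Section smooth_scalar_functions.
Context {R : realType} {V : normedModType R}.
Implicit Types (U : set V) (f g : V -> R).

(** Stated with a pointwise equation for [k], so that it serves both linearity of the vertical
    derivative in the tensor and its multilinearity in the arguments. *)
Lemma derive_comb f g k (a : R) x u :
  differentiable f x -> differentiable g x ->
  (forall y, k y = a * f y + g y) ->
  'D_u k x = a * 'D_u f x + 'D_u g x.
Proof.
move=> df dg kE; rewrite (_ : k = a \*: f + g); last exact/funext.
have {}df := diff_derivable (v := u) df.
have {}dg := diff_derivable (v := u) dg.
by rewrite deriveD ?deriveZ//; exact: derivableZ.
Qed.

(** By the product rule, the derivative is a sum of products of smooth functions. The induction on
    [k] keeps both factors smooth to all orders, since each product pairs an undifferentiated factor
    with a differentiated one. *)
Lemma smooth_onM U f g :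
  open U -> smooth_on U f -> smooth_on U g -> smooth_on U (f * g).
Proof.
move=> oU sf sg k; elim: k f g sf sg => [|k IHk] f g sf sg /=.
  by move=> x Ux; exact: continuousM (sf 0%N x Ux) (sg 0%N x Ux).
split=> [x Ux|v].
  have df := smooth_on_differentiable sf Ux.
  exact: differentiableM df (smooth_on_differentiable sg Ux).
have Dfg := CkD oU (IHk _ _ sf (smooth_on_derive v sg))
                   (IHk _ _ sg (smooth_on_derive v sf)).
apply: Ck_ext oU _ Dfg => x Ux; apply/esym/deriveM; apply: diff_derivable.
  exact: smooth_on_differentiable sf Ux.
exact: smooth_on_differentiable sg Ux.
Qed.

(** The derivative in direction [v] is the constant [f v]. Applied below to the fibre coordinates
    $y^a$. *)
Lemma smooth_on_scalar U f : scalar f -> continuous f -> smooth_on U f.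
Proof.
move=> flin cf [|k] /=; first by move=> x _; exact: cf.
pose g : {scalar V} := HB.pack f (GRing.isLinear.Build _ _ _ _ f flin).
have df x : differentiable g x by exact: linear_differentiable.
split=> [x _|v]; first exact: df.
rewrite (_ : 'D_v f = cst (f v)); first exact: smooth_on_cst.
by apply: funext => x; rewrite -[f]/(g : V -> R) deriveE// diff_lin.
Qed.

Lemma smooth_on_sum U (I : Type) (s : seq I) (F : I -> V -> R) :
  open U -> (forall i, smooth_on U (F i)) -> smooth_on U (\sum_(i <- s) F i).
Proof.
move=> oU sF; elim/big_ind: _ => // [|f g sf sg]; last exact: smooth_onD.
exact: smooth_on_cst.
Qed.

End smooth_scalar_functions.

(** * Multilinear maps and spanning families *)

Section multilinear.
Context {R : realType} {V : lmodType R}.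

Lemma dfwith_id (I : eqType) (T : Type) (X : I -> T) b : dfwith X b (X b) = X.
Proof.
by apply: funext => c; have [<-|bc] := eqVneq b c; rewrite ?dfwithin ?dfwithout.
Qed.

(** Expanding every slot in the family [e] writes [F X] as a linear combination of the functions
    [F (e \o i)], and [P] is closed under such combinations. Below, [P] is differentiability at a
    point, which thus passes from components to all arguments. *)
Lemma multilinear_span (Z : Type) n k (e : 'I_n -> V) (P : set (Z -> R))
    (F : ('I_k -> V) -> Z -> R) :
  (forall u, exists a : 'I_n -> R, u = \sum_i a i *: e i) ->
  P (cst 0) -> (forall a f g, P f -> P g -> P (a \*: f + g)) ->
  (forall z, multilinear (F ^~ z)) -> (forall i, P (F (e \o i))) ->
  forall X, P (F X).
Proof.
move=> span P0 Plin FP Pe.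
(* Induction on [m]: the slots of index at least [m] carry frame vectors. *)
suff PF m X : (forall b : 'I_k, m <= b -> exists i, X b = e i)%N -> P (F X).
  by move=> X; apply: (PF k) => b; rewrite leqNgt ltn_ord.
elim: m X => [|m IHm] X Xe.
  have /choice[i Xi] : forall b, exists i, X b = e i by move=> b; exact: Xe.
  by rewrite (_ : X = e \o i) //; apply: funext => b; exact: Xi.
(* For [k <= m] no slot has index [m], and the induction hypothesis applies at once; otherwise slot
   [m] is expanded in the family. *)
have [mk|km] := ltnP m k; last first.
  by apply: IHm => b mb; have := ltn_ord b; rewrite ltnNge (leq_trans km mb).
pose b := Ordinal mk; rewrite -(dfwith_id X b); have [a ->] := span (X b).
have Pi i : P (F (dfwith X b (e i))).
  apply: IHm => c mc; have [<-|bc] := eqVneq b c.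
    by rewrite dfwithin; exists i.
  rewrite dfwithout//; apply: Xe; rewrite ltn_neqAle mc andbT.
  by move: bc; rewrite -val_eqE.
have -> u : F (dfwith X b u) = (fun u z => F (dfwith X b u) z) u by [].
(* The sum is unwound term by term. The empty sum gives the zero function, because linearity at the
   scalar [-1] and two zero vectors forces the value 0. *)
elim/big_rec: _ => [|i u _ Pu].
  rewrite (_ : (fun z => _) = cst 0)//; apply: funext => z.
  by have := FP z X b (-1) 0 0; rewrite scaler0 addr0 /= mulN1r addNr.
rewrite (_ : (fun z => _) = a i \*: F (dfwith X b (e i)) + F (dfwith X b u)).
  exact: Plin.
by apply: funext => z; exact: FP z X b (a i) (e i) u.
Qed.

End multilinear.

(** * Tensors restricted to a single tangent space *)

Lemma differentiable_pairl (R : realType) (V W : normedModType R) (x : V)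
    (y : W) : differentiable (pair x) y.
Proof. by apply: differentiable_pair => //; exact: differentiable_cst. Qed.

Section fibers.
Context {R : realType} {n : nat} {M : smooth_manifold R n}.

Lemma chart_at_exists (p : M) : exists h : chart_at p, True.
Proof. by have [c cA cp] := atlas_cover p; exists (ChartAt cA cp). Qed.

Lemma chart_at_inj (p : M) (h h' : chart_at p) :
  chart_of h = chart_of h' -> h = h'.
Proof.
case: h h' => [c cA cp] [c' c'A c'p] /= cc'; subst c'.
by congr ChartAt; exact: Prop_irrelevance.
Qed.

Lemma tangent_expansion (p : M) (h : chart_at p) (v : tangent_space p) :
  v = \sum_a tcoord v h 0 a *: partial_ h a.
Proof.
apply: (can_inj (of_coord_tcoord h)); rewrite {1}[tcoord v h]row_sum_delta.
rewrite (big_morph (fun u : tangent_space p => tcoord u h)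
  (id1 := 0) (op1 := +%R))//.
by apply: eq_bigr => a _; rewrite tcoordZ tcoord_of_coord.
Qed.

Lemma covector_sum (V : lmodType R) (w : dual V) (I : Type) (s : seq I)
    (a : I -> R) (u : I -> V) :
  w (\sum_(i <- s) a i *: u i) = \sum_(i <- s) a i * w (u i).
Proof.
have /asboolW wlin := covectorP w.
have w0 : w 0 = 0 by have := wlin (-1) 0 0; rewrite scaler0 addr0 mulN1r addNr.
by elim/big_rec2: _ => // i x y _ <-; rewrite wlin.
Qed.

Lemma cotangent_expansion (p : M) (h : chart_at p) (w : cotangent_space p) :
  w = \sum_a w (partial_ h a) *: dx h a.
Proof.
apply: val_inj; apply: funext => v.
rewrite (big_morph (fun w : cotangent_space p => val w)
  (id1 := 0) (op1 := +%R))// fct_sumE.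
rewrite -[LHS]/(w v) {1}(tangent_expansion h v) covector_sum.
by apply: eq_bigr => a _; rewrite mulrC.
Qed.

Variable A : set (tangent_bundle M).
Hypothesis hA : conic_domain A.

(** Membership only provides some base point [q] with the same chart coordinates; injectivity of the
    chart on its domain forces [q] to be [p]. *)
Lemma natural_imageP (p : M) (h : chart_at p) y :
  natural_image A h (cfun h p, y) -> A (bundle_point (of_coord h y)).
Proof.
move=> [q [h' [u [h'h Au [+ ->]]]]] => /(congr1 (cinv h)).
rewrite !cfunK ?inE -?h'h; last 2 first.
- exact: chart_around.
- by rewrite h'h; exact: chart_around.
by move=> pq; subst q; rewrite -(chart_at_inj h'h) of_coord_tcoord.
Qed.

(** The natural image of [A] is open, and its preimage under the continuous inclusion of the fibre
    over [p] is a neighbourhood. *)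
Lemma fiber_near (p : M) (h : chart_at p) (v : tangent_space p) :
  A (bundle_point v) ->
  \forall y \near tcoord v h, A (bundle_point (of_coord h y)).
Proof.
move=> Av; have pairl_cvg :=
  differentiable_continuous (differentiable_pairl (cfun h p) (tcoord v h)).
have : \forall y \near tcoord v h, natural_image A h (cfun h p, y).
  apply: pairl_cvg; apply: open_nbhs_nbhs; split.
    by apply: conic_open => //; exact: chart_in_atlas.
  by exists p, h, v.
by apply: filterS => y; exact: natural_imageP.
Qed.

Lemma conic_scaleE (p : M) (v : tangent_space p) (l : R) : 0 < l ->
  A (bundle_point (l *: v)) <-> A (bundle_point v).
Proof.
move=> l0; split=> [Alv|Av]; last exact: conic_scale.
have -> : v = l^-1 *: (l *: v) by rewrite scalerA mulVf ?scale1r ?gt_eqF.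
by apply: conic_scale => //; rewrite invr_gt0.
Qed.

Context {r s : nat}.
Implicit Types T S : tensor_field M r s.

(** Transfers [T] to row vectors, where a norm is available; [tangent_space p] carries only a module
    structure. *)
Definition fiber_map T (p : M) (h : chart_at p) w X : 'rV[R]_n -> R :=
  fun y => T p (of_coord h y) w X.

Lemma fiber_map_differentiable T (p : M) (h : chart_at p) v w X :
  anisotropic_tensor A T -> A (bundle_point v) ->
  differentiable (fiber_map T h w X) (tcoord v h).
Proof.
move=> aT Av; pose D g := differentiable (g : 'rV[R]_n -> R) (tcoord v h).
have D0 : D (cst 0) by exact: differentiable_cst.
have Dlin a f g : D f -> D g -> D (a \*: f + g).
  by move=> df dg; apply: differentiableD => //; exact: differentiableZ.
(* The vectors are made arbitrary first, with the covectors kept in the coordinate coframe; the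
   covectors are then freed by a second use of [multilinear_span]. *)
have dX i : forall X, D (fiber_map T h (dx h \o i) X).
  apply: (multilinear_span (e := partial_ h)) => // [u|y|j].
  - by eexists; exact: tangent_expansion.
  - exact: (aniso_cov aT).
  have [f sf Tf] := aniso_smooth aT (chart_in_atlas h) i j.
  have df : differentiable (fun y => f (cfun h p, y)) (tcoord v h).
    apply: (@differentiable_comp _ _ _ _ (fun y => (cfun h p, y)) f).
      exact: differentiable_pairl.
    apply: smooth_on_differentiable sf _; by exists p, h, v.
  apply: near_eq_differentiable df; apply: filterS (fiber_near h Av) => y Ay.
  by rewrite -{1}(tcoord_of_coord h y); exact: Tf.
apply: (@multilinear_span R (cotangent_space p) _ n r (dx h) D
  (fun w => fiber_map T h w X)) => //.
- by move=> u; eexists; exact: cotangent_expansion.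
- by move=> y; exact: (aniso_contra aT).
Qed.

Lemma vertical_derivativeE T (p : M) (h : chart_at p) v w X :
  A (bundle_point v) ->
  vertical_derivative A T v w X =
  'D_(tcoord (X ord_max) h) (fiber_map T h w (X \o lift ord_max)) (tcoord v h).
Proof.
move=> Av; rewrite /vertical_derivative asboolT// derive1E.
set X' := X \o _; set u := X ord_max.
have lineE (t : R) : v + t *: u = of_coord h (t *: tcoord u h + tcoord v h).
  by rewrite -[LHS](of_coord_tcoord h) addrC.
(* Both derivatives are limits of difference quotients, so it suffices that the quotients coincide
   as functions of [t]. *)
suff quotE : (fun t : R => t^-1 *: (((fun t : R => T p (v + t *: u) w X') \o
      shift 0) (t *: 1) - T p (v + 0 *: u) w X')) =
    (fun t : R => t^-1 *: ((fiber_map T h w X' \o shift (tcoord v h))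
      (t *: tcoord u h) - fiber_map T h w X' (tcoord v h))).
  by rewrite /derive quotE.
apply: funext => t /=.
by rewrite /fiber_map addr0 !lineE scale0r add0r /GRing.scale /= mulr1.
Qed.

Lemma vertical_derivative_outside T (p : M) (v : tangent_space p) w X :
  ~ A (bundle_point v) -> vertical_derivative A T v w X = 0.
Proof. by move=> nAv; rewrite /vertical_derivative asboolF. Qed.

End fibers.

(** * Argument families with a distinguished last slot *)

Section extend_last.
Context {V : Type} {s : nat}.
Implicit Types (X : 'I_s -> V) (Y : 'I_s.+1 -> V) (u : V).

Lemma extend_last_max X u : extend_last X u ord_max = u.
Proof. by rewrite /extend_last unlift_none. Qed.

Lemma extend_last_lift X u : extend_last X u \o lift ord_max = X.
Proof. by apply: funext => b; rewrite /extend_last /= liftK. Qed.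

Lemma extend_lastK Y : extend_last (Y \o lift ord_max) (Y ord_max) = Y.
Proof.
by apply: funext => b; rewrite /extend_last; case: unliftP => [b'|] ->.
Qed.

Lemma extend_last_dfwith X u u' :
  extend_last X u = dfwith (extend_last X u') ord_max u.
Proof.
apply: funext => b; rewrite /extend_last; case: unliftP => [b' ->|->] /=.
  by rewrite dfwithout/= ?liftK// neq_lift.
by rewrite dfwithin.
Qed.

Lemma dfwith_extend_last X u b u' :
  extend_last (dfwith X b u') u = dfwith (extend_last X u) (lift ord_max b) u'.
Proof.
apply: funext => c; rewrite /extend_last; case: unliftP => [c' ->|->] /=.
  have [<-|bc] := eqVneq b c'; first by rewrite !dfwithin.
  by rewrite !dfwithout ?liftK// (inj_eq lift_inj).
by rewrite dfwithout ?unlift_none// eq_sym neq_lift.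
Qed.

End extend_last.

(** * Linear structure of the anisotropic and homogeneous tensors *)

Section homogeneous.
Context {R : realType} {n : nat} {M : smooth_manifold R n}.
Variable A : set (tangent_bundle M).
Hypothesis hA : conic_domain A.

Let natural_image_open (c : chart R n M) : atlas c -> open (natural_image A c).
Proof. exact: conic_open. Qed.

Lemma anisotropic_comb r s (a : R) (T S : tensor_field M r s) :
  anisotropic_tensor A T -> anisotropic_tensor A S ->
  anisotropic_tensor A (a *: T + S).
Proof.
move=> aT aS; split.
- move=> p v nAv w X; rewrite -[LHS]/(a * T p v w X + S p v w X).
  by rewrite (aniso_supp aT)// (aniso_supp aS)// mulr0 addr0.
- move=> p v X w b k u u'.
  rewrite -[LHS]/(a * T p v _ X + S p v _ X).
  rewrite (aniso_contra aT) (aniso_contra aS).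
  by rewrite -[in RHS]/(a * T p v _ X + S p v _ X) mulrDr mulrDr !mulrA
    (mulrC a k) addrACA.
- move=> p v w X b k u u'.
  rewrite -[LHS]/(a * T p v w _ + S p v w _) (aniso_cov aT) (aniso_cov aS).
  by rewrite !mulrDr !mulrA (mulrC a k) addrACA.
- move=> c cA i j.
  have [f sf Tf] := aniso_smooth aT cA i j.
  have [g sg Sg] := aniso_smooth aS cA i j.
  exists (cst a * f + g) => [|p h v hc Av].
    have oA := natural_image_open cA.
    by apply: smooth_onD => //; apply: smooth_onM => //; exact: smooth_on_cst.
  by rewrite !fctE (Tf p h v hc Av) (Sg p h v hc Av).
Qed.

Lemma anisotropic0 r s : anisotropic_tensor A (0 : tensor_field M r s).
Proof.
split=> //.
- by move=> p v X w b k u u'; rewrite -[LHS]/(0 : R) mulr0 addr0.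
- by move=> p v w X b k u u'; rewrite -[LHS]/(0 : R) mulr0 addr0.
- by move=> c cA i j; exists (cst 0) => //; exact: smooth_on_cst.
Qed.

Lemma homogeneousP alpha r s (T : tensor_field M r s) :
  homogeneous_tensor A alpha T <-> anisotropic_tensor A T /\
    forall (p : M) (v : tangent_space p) (l : R), A (bundle_point v) ->
    0 < l -> forall w X, T p (l *: v) w X = l `^ alpha * T p v w X.
Proof. by []. Qed.

Lemma homogeneous_anisotropic alpha r s (T : tensor_field M r s) :
  homogeneous_tensor A alpha T -> anisotropic_tensor A T.
Proof. by move=> /homogeneousP[]. Qed.

Lemma homogeneous_subspace alpha r s :
  Defs.subspace (homogeneous_tensor A alpha (r:=r) (s:=s)).
Proof.
split=> [|a T S /homogeneousP[aT hT] /homogeneousP[aS hS]];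
  apply/homogeneousP; split.
- exact: anisotropic0.
- by move=> p v l Av l0 w X; rewrite -[LHS]/(0 : R) mulr0.
- exact: anisotropic_comb.
- move=> p v l Av l0 w X.
  rewrite -[LHS]/(a * T p _ w X + S p _ w X) hT// hS//.
  by rewrite mulrCA -mulrDr.
Qed.

(** Outside [A] both sides vanish, because [A] is invariant under positive scaling. Homogeneity thus
    becomes an identity on whole fibres. *)
Lemma homogeneousE alpha r s (T : tensor_field M r s) (p : M) v (l : R) w X :
  homogeneous_tensor A alpha T -> 0 < l ->
  T p (l *: v) w X = l `^ alpha * T p v w X.
Proof.
move=> hT l0; have aT := homogeneous_anisotropic hT.
have [Av|nAv] := pselect (A (bundle_point v)).
  by move/homogeneousP: hT => [_]; exact.
by rewrite !(aniso_supp aT) ?mulr0// conic_scaleE.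
Qed.

Lemma contraction_linear r s (S : tensor_field M r s.+1) (p : M)
    (v : tangent_space p) w X :
  anisotropic_tensor A S -> scalar (fun u => S p v w (extend_last X u)).
Proof.
(* The vector 0 is a placeholder in the last slot, overwritten by [dfwith]. *)
move=> aS a u u'; rewrite (extend_last_dfwith X _ 0) (aniso_cov aS).
by rewrite -!extend_last_dfwith.
Qed.

(** * The contraction with the Liouville field *)

Section contraction.
Context {r s : nat}.
Implicit Types S : tensor_field M r s.+1.

Lemma liouville_contraction_comb (a : R) S S' :
  liouville_contraction (a *: S + S') =
  a *: liouville_contraction S + liouville_contraction S'.
Proof. by apply: tensor_fieldP. Qed.

Lemma anisotropic_contraction S :
  anisotropic_tensor A S -> anisotropic_tensor A (liouville_contraction S).
Proof.
move=> aS; split.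
- by move=> p v nAv w X; exact: (aniso_supp aS).
- by move=> p v X; exact: (aniso_contra aS).
- move=> p v w X b k u u'; rewrite /liouville_contraction !dfwith_extend_last.
  exact: (aniso_cov aS).
- move=> c cA i j; have oA := natural_image_open cA.
  have /choice[f fP] a : exists f, smooth_on (natural_image A c) f /\
      is_component A S c i (extend_last j a) f.
    by have [f] := aniso_smooth aS cA i (extend_last j a); exists f.
  pose y a (xy : 'rV[R]_n * 'rV[R]_n) := xy.2 0 a.
  have sy a : smooth_on (natural_image A c) (y a).
    apply: smooth_on_scalar => [k u u'|xy]; first by rewrite /y !mxE.
    apply: (@continuous_comp _ _ _ snd (fun z : 'rV[R]_n => z 0 a)).
      exact: cvg_snd.
    exact: coord_continuous.
  exists (\sum_a f a * y a).
    by apply: smooth_on_sum => // a; apply: smooth_onM => //; have [] := fP a.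
  rewrite (_ : \sum_a f a * y a = (fun xy => \sum_a f a xy * xy.2 0 a)).
    by apply: liouville_contraction_component => // a; have [] := fP a.
  by apply: funext => xy; rewrite fct_sumE.
Qed.

(** Scaling [v] by [l] contributes $l^{\alpha-1}$ from [S] and one more factor [l] from the
    contracted slot, by linearity there. *)
Lemma homogeneous_contraction alpha S :
  homogeneous_tensor A (alpha - 1) S ->
  homogeneous_tensor A alpha (liouville_contraction S).
Proof.
move=> hS; have aS := homogeneous_anisotropic hS.
apply/homogeneousP; split; first exact: anisotropic_contraction.
move=> p v l Av l0 w X; rewrite /liouville_contraction /liouville.
rewrite (homogeneousE _ _ _ hS l0).
have Slin := contraction_linear v w X aS.
have S0 := Slin (-1) 0 0; rewrite scaler0 addr0 mulN1r addNr in S0.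
have := Slin l v 0; rewrite addr0 S0 addr0 => ->.
have l_neq0 : l != 0 by rewrite gt_eqF.
by rewrite powRB ?l_neq0 ?implybT// powRr1 ?ltW// mulrA divfK.
Qed.

End contraction.

(** * The vertical derivative and Euler's identity *)

Section vertical.
Context {r s : nat}.
Implicit Types T S : tensor_field M r s.

Lemma vertical_derivative_comb (a : R) T S :
  anisotropic_tensor A T -> anisotropic_tensor A S ->
  vertical_derivative A (a *: T + S) =
  a *: vertical_derivative A T + vertical_derivative A S.
Proof.
move=> aT aS; apply: tensor_fieldP => p v w X.
rewrite -[RHS]/(a * vertical_derivative A T v w X +
  vertical_derivative A S v w X).
have [Av|nAv] := pselect (A (bundle_point v)); last first.
  by rewrite !vertical_derivative_outside// mulr0 addr0.
have [h _] := chart_at_exists p; rewrite !(vertical_derivativeE _ h)//.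
have dT := fiber_map_differentiable hA h w (X \o lift ord_max) aT Av.
have dS := fiber_map_differentiable hA h w (X \o lift ord_max) aS Av.
exact: derive_comb.
Qed.

Lemma anisotropic_vertical_derivative T :
  anisotropic_tensor A T -> anisotropic_tensor A (vertical_derivative A T).
Proof.
move=> aT.
split.
- by move=> p v nAv w X; exact: vertical_derivative_outside.
- move=> p v X w b a u u'.
  have [Av|nAv] := pselect (A (bundle_point v)); last first.
    by rewrite !vertical_derivative_outside// mulr0 addr0.
  have [h _] := chart_at_exists p; rewrite !(vertical_derivativeE _ h)//.
  apply: derive_comb => [||y]; last exact: (aniso_contra aT).
    exact: (fiber_map_differentiable hA).
  exact: (fiber_map_differentiable hA).
- move=> p v w X b a u u'.
  have [Av|nAv] := pselect (A (bundle_point v)); last first.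
    by rewrite !vertical_derivative_outside// mulr0 addr0.
  have [h _] := chart_at_exists p; rewrite !(vertical_derivativeE _ h)//.
  rewrite -(extend_lastK X).
  (* An earlier slot inherits linearity from [T] under the derivative; the last slot is the
     direction of derivation, where linearity is that of the differential. *)
  case: (unliftP ord_max b) => [b' ->|->].
    rewrite -!dfwith_extend_last !extend_last_max !extend_last_lift.
    apply: derive_comb => [||y]; last exact: (aniso_cov aT).
      exact: (fiber_map_differentiable hA).
    exact: (fiber_map_differentiable hA).
  rewrite -!extend_last_dfwith !extend_last_max !extend_last_lift.
  have dT := fiber_map_differentiable hA h w (X \o lift ord_max) aT Av.
  by rewrite !deriveE// tcoordD tcoordZ linearP.
- move=> c cA i j; rewrite -(extend_lastK j).
  have [f sf Tf] := aniso_smooth aT cA i (j \o lift ord_max).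
  exists ('D_((0 : 'rV[R]_n), (delta_mx 0 (j ord_max) : 'rV[R]_n)) f).
    exact: smooth_on_derive.
  by apply: vertical_derivative_component => //; exact: conic_open.
Qed.

(** The chain rule applied to $F(ly) = l^\alpha F(y)$ gives $l\,D_uF(ly) = l^\alpha D_uF(y)$;
    cancelling [l] lowers the degree by one. *)
Lemma homogeneous_vertical_derivative alpha T :
  homogeneous_tensor A alpha T ->
  homogeneous_tensor A (alpha - 1) (vertical_derivative A T).
Proof.
move=> hT; have aT := homogeneous_anisotropic hT.
apply/homogeneousP; split; first exact: anisotropic_vertical_derivative.
move=> p v l Av l0 w X; have [h _] := chart_at_exists p.
have Alv : A (bundle_point (l *: v)) by exact/conic_scaleE.
rewrite !(vertical_derivativeE _ h)//; set F := fiber_map T h w _.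
set u := tcoord (X ord_max) h; rewrite tcoordZ; set y := tcoord v h.
have dF : differentiable F y by exact: (fiber_map_differentiable hA).
have dFl : differentiable F (l *: y).
  by rewrite -tcoordZ; exact: (fiber_map_differentiable hA).
have FE : F \o *:%R l = l `^ alpha \*: F.
  apply: funext => z /=; rewrite /F /fiber_map.
  rewrite (_ : of_coord h (l *: z) = l *: of_coord h z).
    exact: homogeneousE hT l0.
  by apply: (can_inj (of_coord_tcoord h)); rewrite tcoordZ !tcoord_of_coord.
have dl : differentiable ( *:%R l : 'rV[R]_n -> 'rV[R]_n) y by [].
have := derive_comp u dl dFl; rewrite FE deriveZ; last exact: diff_derivable.
rewrite (deriveE _ dl) diff_val (deriveE _ dFl) linearZ -(deriveE _ dFl) => E.
apply: (@mulfI _ l); first by rewrite gt_eqF.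
rewrite -[LHS]E -[LHS]/(_ * _).
have l_neq0 : l != 0 by rewrite gt_eqF.
by rewrite powRB ?l_neq0 ?implybT// powRr1 ?ltW// mulrA mulrCA mulfV// mulr1.
Qed.

Lemma contraction_vertical_derivative alpha T :
  homogeneous_tensor A alpha T ->
  liouville_contraction (vertical_derivative A T) = alpha *: T.
Proof.
move=> hT; have aT := homogeneous_anisotropic hT.
apply: tensor_fieldP => p v w X.
rewrite -[RHS]/(alpha * T p v w X) /liouville_contraction /liouville.
have [Av|nAv] := pselect (A (bundle_point v)); last first.
  by rewrite vertical_derivative_outside// (aniso_supp aT)// mulr0.
rewrite /vertical_derivative asboolT// extend_last_max extend_last_lift.
rewrite derive1E.
(* Homogeneity needs a positive factor: [t + 1 > 0] holds once [t] exceeds [-1], hence near 0. *)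
have line_powR : \forall t \near (0 : R),
    T p (v + t *: v) w X = (T p v w X \*: ((@powR R)^~ alpha \o shift 1)) t.
  near=> t; have -> : v + t *: v = (t + 1) *: v.
    by rewrite scalerDl scale1r addrC.
  rewrite (homogeneousE _ _ _ hT) /=; first by rewrite /GRing.scale/= mulrC.
  by rewrite -ltrBlDr sub0r; near: t; apply: lt_nbhsr; rewrite oppr_lt0.
rewrite (near_eq_derive _ line_powR).
have dpow : is_derive (1 : R) 1 ((@powR R)^~ alpha) alpha.
  by have := is_derive1_powR alpha (@ltr01 R); rewrite powR1 mulr1.
have diff_pow : differentiable ((@powR R)^~ alpha) (shift 1 (0 : R)).
  by rewrite /= add0r; apply/derivable1_diffP.
have diff_shift : differentiable (shift (1 : R)) (0 : R).
  exact/derivable1_diffP.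
rewrite deriveZ; last exact/diff_derivable/differentiable_comp.
rewrite (derive_comp _ diff_shift diff_pow).
rewrite (@derive_val _ _ _ _ _ _ _ (is_derive_shift (0 : R) 1 1)) /= add0r.
rewrite derive_val.
by rewrite /GRing.scale/= mulrC.
Unshelve. all: by end_near.
Qed.

End vertical.
End homogeneous.

(** * Splitting of the target by Euler's identity *)

Theorem proposition1 (R : realType) (n : nat) (M : smooth_manifold R n)
    (A : set (tangent_bundle M)) (hA : conic_domain A) (r s : nat) (alpha : R) :
  let hT := homogeneous_tensor A alpha (r:=r) (s:=s) in
  let hT' := homogeneous_tensor A (alpha - 1) (r:=r) (s:=s.+1) in
  let iota := @liouville_contraction R n M r s in
  let del := @vertical_derivative R n M A r s in
  let img := del @` hT in
  let ker := hT' `&` iota @^-1` [set 0] in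
  [/\ set_fun hT' hT iota,
      set_fun hT hT' del,
      (forall T, hT T -> iota (del T) = alpha *: T) &
      alpha != 0 ->
      [/\ set_surj hT' hT iota,
          set_inj hT del,
          direct_sum hT' img ker,
          projection hT' img ker (fun S => del (alpha^-1 *: iota S)) &
          projection hT' ker img (fun S => S - del (alpha^-1 *: iota S))]].
Proof.
move=> hT hT' iota del img ker.
have iota_fun : set_fun hT' hT iota by move=> S; exact: homogeneous_contraction.
have del_fun : set_fun hT hT' del.
  by move=> T; exact: homogeneous_vertical_derivative.
have iota_del T : hT T -> iota (del T) = alpha *: T.
  exact: contraction_vertical_derivative.
split=> // alpha0.
have hT_sub : Defs.subspace hT by exact: homogeneous_subspace.
have hT'_sub : Defs.subspace hT' by exact: homogeneous_subspace.
have del_comb a T S : hT T -> hT S -> del (a *: T + S) = a *: del T + del S.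
  by move=> /homogeneous_anisotropic aT /homogeneous_anisotropic aS;
    exact: vertical_derivative_comb.
have iota_comb a S S' : iota (a *: S + S') = a *: iota S + iota S'.
  exact: liouville_contraction_comb.
have hTZ a T : hT T -> hT (a *: T).
  by move=> hTT; rewrite -[_ *: _]addr0; apply: hT_sub.2 => //; exact: hT_sub.1.
have hT'D S S' : hT' S -> hT' S' -> hT' (S + S').
  by move=> hS hS'; rewrite -[S]scale1r; exact: hT'_sub.2.
have del0 : del 0 = 0.
  have := del_comb (-1) 0 0 hT_sub.1 hT_sub.1.
  by rewrite scaler0 addr0 scaleN1r addNr.
have iotaB S S' : iota (S - S') = iota S - iota S' by [].
have section T : hT T -> alpha^-1 *: iota (del T) = T.
  by move=> hTT; rewrite iota_del// scalerA mulVf// scale1r.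
have img_hT' S : img S -> hT' S by move=> [T hTT <-]; exact: del_fun.
pose P S := del (alpha^-1 *: iota S).
have img_P S : hT' S -> img (P S).
  by move=> hS; exists (alpha^-1 *: iota S) => //; apply: hTZ; exact: iota_fun.
have ker_P S : hT' S -> ker (S - P S).
  move=> hS; split.
    rewrite addrC -scaleN1r; apply: hT'_sub.2 => //; exact/img_hT'/img_P.
  rewrite /preimage/= iotaB iota_del; last by apply: hTZ; exact: iota_fun.
  by rewrite scalerA mulfV// scale1r subrr.
(* The contraction kills [u2], and on [u1 = del T] the scaled contraction recovers [T]. Both
   projection formulas rest on this. *)
have P_img_ker u1 u2 : img u1 -> ker u2 -> P (u1 + u2) = u1.
  move=> [T hTT <-] [_ iota_u2]; rewrite /P -[del T]scale1r iota_comb.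
  by rewrite iota_u2 addr0 !scale1r section.
split.
- move=> T hTT; exists (del (alpha^-1 *: T)).
    by apply: del_fun; exact: hTZ.
  by rewrite iota_del ?scalerA ?mulfV ?scale1r//; exact: hTZ.
- move=> T T' /[!inE] hTT hTT' TT'.
  by rewrite -(section _ hTT) TT' section.
- split=> //.
  + split=> [|a _ _ [T hTT <-] [T' hTT' <-]].
      by exists 0 => //; exact: hT_sub.1.
    by exists (a *: T + T'); [exact: hT_sub.2|exact: del_comb].
  + split=> [|a S S' [hS iS] [hS' iS']]; first by split => //; exact: hT'_sub.1.
    split; first exact: hT'_sub.2.
    by rewrite /preimage/= iota_comb iS iS' scaler0 addr0.
  + apply/seteqP; split=> [S hS|_ [u1 iu1 [u2 [hu2 _] <-]]].
      exists (P S); first exact: img_P.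
      by exists (S - P S); [exact: ker_P|rewrite addrC subrK].
    by apply: hT'D => //; exact: img_hT'.
  (* If [del T] lies in the kernel, then [section] writes [T] as a multiple of its zero contraction,
     so [del T] is [del 0]. *)
  + apply/seteqP; split=> [S [[T hTT <-] [_ iS]]|_ ->].
      by rewrite /= -(section _ hTT) iS scaler0 del0.
    split; first by exists 0 => //; exact: hT_sub.1.
    by split => //; exact: hT'_sub.1.
- by split; [exact: img_P|exact: P_img_ker].
- split; first exact: ker_P.
  (* The summands are swapped because [P_img_ker] expects the image part first. *)
  by move=> u1 u2 ku1 iu2; rewrite -[X in _ - X]/(P _) [u1 + u2]addrC
    P_img_ker// addrAC subrr add0r.
Qed.
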